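(* Let $n\ge 1$, let $A,B,N\in\mathbb{M}_n$, and suppose that the block matrix $\begin{bmatrix} A & N\\ N^* & B\end{bmatrix}\in\mathbb{M}_{2n}$ is positive. If $N$ is normal and its spectrum is contained in a disc of radius $r$ in $\mathbb{C}$, then, for all $j=0,1,\ldots,n-1$, $$ \lambda_{1+2j}\left(\begin{bmatrix} A & N\\ N^* & B\end{bmatrix}\right)\le \lambda_{1+j}(A+B)+r. $$
   Context: $\mathbb{M}_n$ is the space of $n\times n$ complex matrices; ''positive'' means positive semidefinite (Hermitian). For a Hermitian matrix $S\in\mathbb{M}_d$, $\lambda_1(S)\ge\cdots\ge\lambda_d(S)$ denote its eigenvalues in decreasing order, counted with multiplicity. *)

(* Defs.v *)
From mathcomp Require Import all_boot all_order all_algebra.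
From mathcomp Require Import all_reals.
From mathcomp Require Export complex.
Set Implicit Arguments.
Unset Strict Implicit.
Unset Printing Implicit Defensive.
Import Order.TTheory GRing.Theory Num.Theory.
Local Open Scope ring_scope.
Local Open Scope sesquilinear_scope.
Local Open Scope complex_scope.

Definition possemidef (R : realType) (d : nat) (S : 'M[R[i]]_d) : Prop :=
  S \is hermsymmx /\
  forall x : 'cV[R[i]]_d, 0 <= (x ^t* *m S *m x) ord0 ord0.

Definition char_roots (R : realType) (d : nat) (S : 'M[R[i]]_d) : seq R[i] :=
  sval (closed_field_poly_normal (char_poly S)).

(* Taking real parts lets the eigenvalues be sorted in R; it loses nothing when
   S is Hermitian (see [char_poly_eigseq]), the only case in which [eigseq] and
   [lambda] are meaningful. *)
Definition eigseq (R : realType) (d : nat) (S : 'M[R[i]]_d) : seq R :=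
  sort >=%R [seq complex.Re z | z <- char_roots S].

(* Numbered from 1 to d; [lambda S k] is junk outside this range. *)
Definition lambda (R : realType) (d : nat) (S : 'M[R[i]]_d) (k : nat) : R :=
  nth 0 (eigseq S) k.-1.

Lemma char_rootsE (R : realType) (d : nat) (S : 'M[R[i]]_d) :
  char_poly S = \prod_(z <- char_roots S) ('X - z%:P).
Proof.
rewrite /char_roots; case: closed_field_poly_normal => s /= {1}->.
by rewrite (monicP (char_poly_monic S)) scale1r.
Qed.

Lemma size_eigseq (R : realType) (d : nat) (S : 'M[R[i]]_d) :
  size (eigseq S) = d.
Proof.
rewrite size_sort size_map; apply: succn_inj.
by rewrite -(size_char_poly S) char_rootsE size_prod_XsubC.
Qed.

Lemma eigseq_sorted (R : realType) (d : nat) (S : 'M[R[i]]_d) :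
  sorted >=%R (eigseq S).
Proof. by apply: sort_sorted => x y; apply: le_total. Qed.

Lemma herm_root_real (R : realType) (d : nat) (S : 'M[R[i]]_d) (z : R[i]) :
  S \is hermsymmx -> root (char_poly S) z -> z \is Num.real.
Proof.
move=> hS; rewrite -eigenvalue_root_char => /eigenvalueP[v vS vn0].
have S_adj : S ^t* = S.
  by move/is_hermitianmxP: hS; rewrite expr0 scale1r => <-.
have q0 : (v *m v ^t*) 0 0 != 0.
  by rewrite -dotmxE gt_eqF // (dnorm_gt0 (@dotmx _ d) v).
apply/CrealP/(mulIf q0).
have : (v *m S *m v ^t*) 0 0 = (v *m (v *m S) ^t*) 0 0.
  by rewrite trmx_mul map_mxM /= S_adj mulmxA.
rewrite vS -scalemxAl linearZ /= map_mxZ -scalemxAr !mxE => ->.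
by [].
Qed.

Lemma char_poly_eigseq (R : realType) (d : nat) (S : 'M[R[i]]_d) :
  S \is hermsymmx -> char_poly S = \prod_(x <- eigseq S) ('X - (x%:C)%:P).
Proof.
move=> hS; rewrite (perm_big _ (permEl (perm_sort _ _))) /= big_map.
rewrite {1}char_rootsE; apply: eq_big_seq => z zS.
by rewrite RRe_real // (herm_root_real hS) // char_rootsE root_prod_XsubC.
Qed.

(* Main.v *)
(** Write M for the block matrix and mu for lambda_(1+j)(A+B).  The vectors
    (u, v) with u and v both in the span of the eigenvectors of A+B of index
    > j form a space of codimension 2j, which meets the span of the 1+2j top
    eigenvectors of M; so it suffices to bound the form of M by mu + r on such
    a (u, v).

    Let W be a two-dimensional space containing u and v.  By Schur, the
    compression of N to W is triangular in an orthonormal basis, and its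
    off-diagonal entry is that of N - c, hence at most r in modulus.  Rotating
    N by a phase w that makes the difference of the two diagonal entries
    imaginary puts the numerical range of the compression into a vertical
    strip of width r (not 2r).

    Split (u, v) = (u', w^* u') + (v', - w^* v').  The form of M on the two
    pieces is that of A+B plus, resp. minus, twice the real part of the
    rotated N.  A positive form bounded by p a and q b on two vectors is
    bounded by (p+q)(a+b) on their sum, and the centre of the strip cancels
    in p+q. *)
Require Import Defs.
From mathcomp Require Import all_boot all_order all_algebra.
From mathcomp Require Import all_reals.
From mathcomp Require Import complex perm.
From mathcomp Require Import zify ring lra.
Set Implicit Arguments.
Unset Strict Implicit.
Unset Printing Implicit Defensive.
Import Order.TTheory GRing.Theory Num.Theory.
Local Open Scope sesquilinear_scope.
Local Open Scope complex_scope.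
(* Opened last, so that [^*] is [Num.conj] and not [conjc]. *)
Local Open Scope ring_scope.

(** * Sesquilinear forms and squared norms *)

Section SesquilinearForm.
Variable R : realType.
Local Notation C := R[i].
Local Notation Re := (@complex.Re R).

(** Vectors are rows here: [form M x x] is the usual v^* M v for the column v = x^*. *)
Definition form (m n : nat) (M : 'M[C]_(m, n)) (x : 'rV_m) (y : 'rV_n) : C :=
  (x *m M *m y ^t*) 0 0.

(** The squared modulus, with values in [R], so that estimates become polynomial inequalities in
    real and imaginary parts. *)
Definition sqnormc (z : C) : R := Re z ^+ 2 + complex.Im z ^+ 2.

Definition sqnorm (n : nat) (x : 'rV[C]_n) : R := \sum_k sqnormc (x 0 k).

Lemma ReD (z w : C) : Re (z + w) = Re z + Re w.
Proof. by case: z w => [a b] [c d]. Qed.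

Lemma ReN (z : C) : Re (- z) = - Re z.
Proof. by case: z. Qed.

Lemma ReM_real (a : R) (z : C) : Re (a%:C * z) = a * Re z.
Proof. by case: z => b c /=; rewrite mul0r subr0. Qed.

Lemma Re_conj (z : C) : Re z^* = Re z.
Proof. by case: z. Qed.

Lemma Re_sum (I : finType) (F : I -> C) : Re (\sum_i F i) = \sum_i Re (F i).
Proof. by apply: (big_morph Re ReD). Qed.

Lemma conjC_real (a : R) : (a%:C)^* = a%:C.
Proof. exact: conjc_real. Qed.

Lemma mulc_conj (z : C) : z * z^* = (sqnormc z)%:C.
Proof. by rewrite -sqr_normc -add_Re2_Im2. Qed.

Lemma sqnormc_ge0 (z : C) : 0 <= sqnormc z.
Proof. by rewrite addr_ge0 ?sqr_ge0. Qed.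

Lemma sqnormcM (z w : C) : sqnormc (z * w) = sqnormc z * sqnormc w.
Proof. by case: z w => [a b] [c d]; rewrite /sqnormc /=; ring. Qed.

Lemma sqnorm_ge0 (n : nat) (x : 'rV[C]_n) : 0 <= sqnorm x.
Proof. by rewrite sumr_ge0 // => k _; apply: sqnormc_ge0. Qed.

Lemma sqnorm_eq0 (n : nat) (x : 'rV[C]_n) : (sqnorm x == 0) = (x == 0).
Proof.
apply/eqP/eqP => [/eqP|->]; last first.
  by rewrite /sqnorm big1 // => k _; rewrite mxE /sqnormc /= expr0n addr0.
rewrite psumr_eq0 => [/allP x0|k _]; last exact: sqnormc_ge0.
apply/rowP => k; have := x0 k (mem_index_enum k).
rewrite mxE paddr_eq0 ?sqr_ge0 // !sqrf_eq0 /= => /andP[/eqP a0 /eqP b0].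
by case: (x 0 k) a0 b0 => a b /= -> ->.
Qed.

Lemma sqnormZ (n : nat) (a : C) (x : 'rV[C]_n) :
  sqnorm (a *: x) = sqnormc a * sqnorm x.
Proof. by rewrite mulr_sumr; apply: eq_bigr => k _; rewrite mxE sqnormcM. Qed.

Lemma sqnorm_parallelogram (n : nat) (x y : 'rV[C]_n) :
  sqnorm (x + y) + sqnorm (x - y) = 2 * (sqnorm x + sqnorm y).
Proof.
rewrite /sqnorm -!big_split mulr_sumr; apply: eq_bigr => k _ /=; rewrite !mxE.
by case: (x 0 k) (y 0 k) => [a b] [c d]; rewrite /sqnormc /=; ring.
Qed.

Lemma sqnorm_row_mx (m n : nat) (x : 'rV[C]_m) (y : 'rV[C]_n) :
  sqnorm (row_mx x y) = sqnorm x + sqnorm y.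
Proof.
rewrite /sqnorm big_split_ord /=.
by congr (_ + _); apply: eq_bigr => k _; rewrite ?row_mxEl ?row_mxEr.
Qed.

Lemma ctrD (m n : nat) (M N : 'M[C]_(m, n)) : (M + N) ^t* = M ^t* + N ^t*.
Proof. by rewrite linearD /= map_mxD. Qed.

Lemma ctrZ (m n : nat) (a : C) (M : 'M[C]_(m, n)) :
  (a *: M) ^t* = a^* *: M ^t*.
Proof. by rewrite linearZ /= map_mxZ. Qed.

Lemma ctrM (m n p : nat) (M : 'M[C]_(m, n)) (N : 'M[C]_(n, p)) :
  (M *m N) ^t* = N ^t* *m M ^t*.
Proof. by rewrite trmx_mul map_mxM. Qed.

Lemma formDl (m n : nat) (M : 'M[C]_(m, n)) x y z :
  form M (x + y) z = form M x z + form M y z.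
Proof. by rewrite /form !mulmxDl mxE. Qed.

Lemma formDr (m n : nat) (M : 'M[C]_(m, n)) x y z :
  form M x (y + z) = form M x y + form M x z.
Proof. by rewrite /form ctrD mulmxDr mxE. Qed.

Lemma formZl (m n : nat) (M : 'M[C]_(m, n)) a x y :
  form M (a *: x) y = a * form M x y.
Proof. by rewrite /form -!scalemxAl mxE. Qed.

Lemma formZr (m n : nat) (M : 'M[C]_(m, n)) a x y :
  form M x (a *: y) = a^* * form M x y.
Proof. by rewrite /form ctrZ -scalemxAr mxE. Qed.

Lemma formDm (m n : nat) (M N : 'M[C]_(m, n)) x y :
  form (M + N) x y = form M x y + form N x y.
Proof. by rewrite /form mulmxDr mulmxDl mxE. Qed.

Lemma form_ctr (m n : nat) (M : 'M[C]_(m, n)) x y :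
  form (M ^t*) x y = (form M y x)^*.
Proof.
have -> : (form M y x)^* = ((y *m M *m x ^t*) ^t*) 0 0.
  by rewrite [RHS]mxE [in RHS]mxE.
by rewrite !ctrM trmxCK mulmxA.
Qed.

Lemma form1 (n : nat) (x : 'rV[C]_n) : form 1%:M x x = (sqnorm x)%:C.
Proof.
rewrite /form mulmx1 mxE /sqnorm rmorph_sum; apply: eq_bigr => k _ /=.
by rewrite !mxE -mulc_conj.
Qed.

Lemma form_scalar (n : nat) (a : C) (x : 'rV[C]_n) :
  form a%:M x x = a * (sqnorm x)%:C.
Proof. by rewrite -form1 /form mul_mx_scalar -scalemxAl mxE mulmx1. Qed.

Lemma form_block (n : nat) (A N L B : 'M[C]_n) u v w z :
  form (block_mx A N L B) (row_mx u v) (row_mx w z)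
  = form A u w + form N u z + form L v w + form B v z.
Proof.
rewrite /form mul_row_block tr_row_mx map_col_mx mul_row_col !mulmxDl.
by rewrite !mxE addrACA !addrA.
Qed.

Lemma form_diag (n : nat) (P : 'M[C]_n) (d : 'rV[C]_n) x y :
  form (P ^t* *m diag_mx d *m P) x y
  = \sum_k (x *m P ^t*) 0 k * d 0 k * ((y *m P ^t*) 0 k)^*.
Proof.
rewrite /form !mulmxA -[_ *m P *m _]mulmxA.
have -> : P *m y ^t* = (y *m P ^t*) ^t* by rewrite ctrM trmxCK.
rewrite mul_mx_diag mxE; apply: eq_bigr => k _.
by rewrite !mxE.
Qed.

Lemma sqnorm_unitary (m n : nat) (P : 'M[C]_(m, n)) (x : 'rV[C]_m) :
  P \is unitarymx -> sqnorm (x *m P) = sqnorm x.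
Proof.
move=> /unitarymxP uP; apply: complexI.
by rewrite -!form1 /form ctrM !mulmx1 mulmxA -[_ *m P *m _]mulmxA uP mulmx1.
Qed.

End SesquilinearForm.

(** * Unitary diagonalization and ordered eigenvalues *)

Section Spectral.
Variable R : realType.
Local Notation C := R[i].
Local Notation Re := (@complex.Re R).

Lemma char_poly_conj (n : nat) (P S : 'M[C]_n) :
  P \in unitmx -> char_poly (invmx P *m S *m P) = char_poly S.
Proof.
move=> uP; pose f := map_mx (@polyC C).
have fP : f n n (invmx P) *m f n n P = 1%:M.
  by rewrite -map_mxM mulVmx // map_mx1.
have E : char_poly_mx (invmx P *m S *m P)
         = f n n (invmx P) *m char_poly_mx S *m f n n P.
  rewrite /char_poly_mx mulmxBr mulmxBl !map_mxM; congr (_ - _).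
  by rewrite scalar_mxC -mulmxA fP mulmx1.
by rewrite /char_poly E !det_mulmx mulrAC -det_mulmx fP det1 mul1r.
Qed.

Lemma unitary_diag (n : nat) (N : 'M[C]_n) :
  N \is normalmx ->
  exists2 P : 'M[C]_n, P \is unitarymx &
    exists2 d : 'rV_n, N = P ^t* *m diag_mx d *m P &
      char_poly N = \prod_k ('X - (d 0 k)%:P).
Proof.
move=> /orthomx_spectralP NE; have uP := spectral_unitarymx N.
exists (spectralmx N) => //; exists (spectral_diag N).
  by rewrite -invmx_unitary.
rewrite {1}NE char_poly_conj ?unitarymx_unit //.
rewrite char_poly_trig ?diag_mx_is_trig //.
by apply: eq_bigr => k _; rewrite mxE eqxx mulr1n.
Qed.

(** The columns of [T] are an orthonormal eigenbasis, permuted to follow the decreasing order of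
    [eigseq S]. The permutation comes from the two factorizations of the characteristic polynomial
    into linear factors. *)
Lemma spectral_form (n : nat) (S : 'M[C]_n) :
  S \is hermsymmx ->
  exists T : 'M[C]_n, forall x : 'rV_n,
    sqnorm x = \sum_(k < n) sqnormc ((x *m T) 0 k) /\
    Re (form S x x) = \sum_(k < n) (eigseq S)`_k * sqnormc ((x *m T) 0 k).
Proof.
move=> hS; have [P uP [d SE pS]] := unitary_diag (hermitian_normalmx hS).
pose s : seq C := [seq x%:C | x <- eigseq S].
have ss : size s == n by rewrite size_map size_eigseq.
have : perm_eq (Tuple ss) [tuple d 0 i | i < n].
  by apply: prod_XsubC_eq; rewrite /= !big_map -char_poly_eigseq // pS.
case/tuple_permP => p sE.
have dE k : d 0 (p k) = ((eigseq S)`_k)%:C.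
  have -> : ((eigseq S)`_k)%:C = tnth (Tuple ss) k.
    by rewrite (tnth_nth 0) /= (nth_map 0) // size_eigseq.
  have -> : Tuple ss = [tuple tnth [tuple d 0 i | i < n] (p i) | i < n].
    exact: val_inj.
  by rewrite !tnth_mktuple.
exists (colsub p (P ^t*)) => x.
have xT k : (x *m colsub p (P ^t*)) 0 k = (x *m P ^t*) 0 (p k).
  by rewrite !mxE; apply: eq_bigr => i _; rewrite !mxE.
split.
  rewrite -(@sqnorm_unitary _ _ _ (P ^t*)) ?trmxC_unitary //.
  rewrite /sqnorm (reindex_inj (@perm_inj _ p)).
  by apply: eq_bigr => k _; rewrite xT.
rewrite SE form_diag Re_sum (reindex_inj (@perm_inj _ p)) -SE.
apply: eq_bigr => k _; rewrite xT dE mulrAC mulc_conj mulrC ReM_real /=.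
by rewrite mulrC.
Qed.

Lemma eigseq_nth_anti (n : nat) (S : 'M[C]_n) (i k : nat) :
  (i <= k)%N -> (k < n)%N -> (eigseq S)`_k <= (eigseq S)`_i.
Proof.
move=> ik kn.
have tr : transitive (>=%R : rel R).
  by move=> x y z yx zy; apply: le_trans zy yx.
apply: (sorted_leq_nth tr _ _ (eigseq_sorted S)) => //.
- by move=> x; exact: lexx.
- by rewrite inE size_eigseq (leq_ltn_trans ik).
- by rewrite inE size_eigseq.
Qed.

Lemma exists_left_kernel (m p : nat) (K : 'M[C]_(m, p)) :
  (p < m)%N -> exists2 x : 'rV_m, x != 0 & x *m K = 0.
Proof.
move=> pm; have /rowV0Pn[x /sub_kermxP xK x0] : kermx K != 0.
  rewrite -mxrank_eq0 mxrank_ker subn_eq0 -ltnNge.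
  exact: leq_ltn_trans (rank_leq_col K) pm.
by exists x.
Qed.

End Spectral.

(** * Numerical range of the compressed normal block, and the bound on the block form *)

Section BlockBound.
Variable R : realType.
Local Notation C := R[i].
Local Notation Re := (@complex.Re R).

Lemma Re_mul_le (r : R) (b z w : C) :
  0 <= r -> sqnormc b <= r ^+ 2 ->
  Re (b * (z * w^*)) <= r / 2 * (sqnormc z + sqnormc w).
Proof.
move=> r0 br; have [rp|] := ltP 0 r; last first.
  move=> rn; have rE : r = 0 by apply/eqP; rewrite eq_le rn r0.
  move: br; rewrite rE mul0r mul0r; case: b z w => [b1 b2] [z1 z2] [w1 w2].
  rewrite /sqnormc /= => h; have -> : b1 = 0 by nra.
  have -> : b2 = 0 by nra.
  by rewrite !mul0r subr0.
have h1 := sqnormc_ge0 (r%:C * w - b * z); have h2 := sqnormc_ge0 z.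
rewrite -(ler_pM2l rp); move: br h1 h2.
case: b z w => [b1 b2] [z1 z2] [w1 w2]; rewrite /sqnormc /=.
nra.
Qed.

(** In an orthonormal eigenbasis N - c is diagonal with entries of modulus at most r. The conclusion
    encodes that the operator norm of N - c is at most r, in a shape that compressions inherit
    directly. *)
Lemma normal_disc_form (n : nat) (N : 'M[C]_n) (c : C) (r : R) :
  N \is normalmx ->
  (forall a, eigenvalue N a -> `|a - c| <= r%:C) ->
  forall w x y, sqnormc w = 1 ->
    Re (w * form (N - c%:M) x y) <= r / 2 * (sqnorm x + sqnorm y).
Proof.
move=> nN disc w x y w1; have [P uP [d NE pN]] := unitary_diag nN.
have dr k : 0 <= r /\ sqnormc (w * (d 0 k - c)) <= r ^+ 2.
  have /disc dk : eigenvalue N (d 0 k).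
    rewrite eigenvalue_root_char pN rootE horner_prod (bigD1 k) //=.
    by rewrite hornerXsubC subrr mul0r.
  have r0 : 0 <= r by rewrite -ler0c (le_trans _ dk).
  split=> //; rewrite sqnormcM w1 mul1r -lecR add_Re2_Im2 rmorphXn /=.
  by rewrite ler_sqr ?nnegrE ?normr_ge0 ?ler0c.
have -> : N - c%:M = P ^t* *m diag_mx (d - const_mx c) *m P.
  rewrite linearB /= diag_const_mx mulmxBr mulmxBl -NE scalar_mxC -mulmxA.
  by rewrite -invmx_unitary // mulVmx ?unitarymx_unit // mulmx1.
rewrite form_diag mulr_sumr Re_sum.
rewrite -(@sqnorm_unitary _ _ _ (P ^t*) x) ?trmxC_unitary //.
rewrite -(@sqnorm_unitary _ _ _ (P ^t*) y) ?trmxC_unitary //.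
rewrite /sqnorm -big_split mulr_sumr; apply: ler_sum => k _ /=.
have [r0 drk] := dr k; move: (x *m _) (y *m _) => X Y.
rewrite !mxE.
rewrite (_ : w * _ = w * (d 0 k - c) * (X 0 k * (Y 0 k)^* )); last by ring.
exact: Re_mul_le.
Qed.

Lemma exists_phase (d : C) : exists2 w : C, sqnormc w = 1 & Re (w * d) = 0.
Proof.
have [->|d0] := eqVneq d 0.
  by exists 1; rewrite ?mulr0 // /sqnormc /= expr1n expr0n addr0.
pose s := Num.sqrt (sqnormc d).
have s0 : s != 0.
  rewrite sqrtr_eq0 -ltNge lt_def sqnormc_ge0 andbT.
  apply: contra d0; rewrite /sqnormc paddr_eq0 ?sqr_ge0 // !sqrf_eq0.
  by case: d {s} => a b /= /andP[/eqP-> /eqP->].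
have sE : s ^+ 2 = sqnormc d by rewrite sqr_sqrtr ?sqnormc_ge0.
(* This is i d^* / |d|, so that w d = i |d|. *)
exists (Complex (complex.Im d / s) (Re d / s)).
  rewrite /sqnormc /= !expr_div_n -mulrDl addrC -/(sqnormc d) -sE divff //.
  by rewrite sqrf_eq0.
by case: d d0 @s s0 sE => a b _ s s0 sE /=; field.
Qed.

Lemma form_mulmx (m n : nat) (M : 'M[C]_n) (W : 'M[C]_(m, n)) x y :
  form M (x *m W) (y *m W) = form (W *m M *m W ^t*) x y.
Proof. by rewrite /form ctrM !mulmxA. Qed.

Lemma trig_numerical_strip (T : 'M[C]_2) (c : C) (r : R) :
  T 0 1 = 0 ->
  (forall w x y, sqnormc w = 1 ->
     Re (w * form (T - c%:M) x y) <= r / 2 * (sqnorm x + sqnorm y)) ->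
  exists w : C, exists2 t : R, sqnormc w = 1 & forall x,
    `|Re (w * form T x x) - t * sqnorm x| <= r / 2 * sqnorm x.
Proof.
move=> T01 hT; have [w w1 wd] := exists_phase (T 0 0 - T 1 1).
exists w; exists (Re (w * T 0 0)) => // x.
pose x0 := x 0 0; pose x1 := x 0 1.
have formE (S : 'M[C]_2) (y z : 'rV_2) : form S y z =
    y 0 0 * S 0 0 * (z 0 0)^* + y 0 0 * S 0 1 * (z 0 1)^*
    + (y 0 1 * S 1 0 * (z 0 0)^* + y 0 1 * S 1 1 * (z 0 1)^* ).
  rewrite /form mxE big_ord_recl big_ord1 !mxE !big_ord_recl !big_ord0 !addr0.
  rewrite (_ : lift ord0 ord0 = 1); last exact: val_inj.
  by ring.
have sqE (y : 'rV[C]_2) : sqnorm y = sqnormc (y 0 0) + sqnormc (y 0 1).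
  rewrite /sqnorm big_ord_recl big_ord1.
  by rewrite (_ : lift ord0 ord0 = 1) //; exact: val_inj.
(* On multiples of two distinct basis vectors the hypothesis sees only the entry [T 1 0], which
   subtracting c does not change. *)
have key e : sqnormc e = 1 ->
    Re (e * (x1 * T 1 0 * x0^* )) <= r / 2 * sqnorm x.
  move=> e1; have := hT e (x1 *: delta_mx 0 1) (x0 *: delta_mx 0 0) e1.
  rewrite formE !sqE !mxE /= !(mulr1, mulr0, mul0r, addr0, add0r, subr0, mulr0n).
  rewrite conjC0 mulr0 addr0 -/x0 -/x1 (_ : sqnormc 0 = 0 :> R).
    by rewrite addr0 add0r [sqnormc x1 + _]addrC.
  by rewrite /sqnormc /= expr0n addr0.
(* By the choice of phase both diagonal entries of w T have real part t, so the diagonal contributes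
   exactly t |x|^2. *)
have -> : Re (w * form T x x) - Re (w * T 0 0) * sqnorm x
          = Re (w * (x1 * T 1 0 * x0^* )).
  rewrite formE sqE -/x0 -/x1 T01 mulr0 mul0r addr0.
  rewrite (_ : w * _ = x0 * x0^* * (w * T 0 0) + w * (x1 * T 1 0 * x0^* )
    + x1 * x1^* * (w * T 1 1)); last by ring.
  move: wd; rewrite mulrBr ReD ReN => /eqP; rewrite subr_eq0 => /eqP wd.
  by rewrite !mulc_conj !ReD !ReM_real -wd; ring.
(* The two sides of the absolute value are [key] at w and at - w. *)
rewrite ler_norml key // andbT -lerNl -ReN -mulNr key //.
by case: w w1 {wd} => a b; rewrite /sqnormc /= !sqrrN.
Qed.

(** One pair [w], [t] has to serve the whole span of u and v, because the vectors to which the strip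
    is later applied depend on w. *)
Lemma two_dim_numerical_strip (n : nat) (N : 'M[C]_n) (c : C) (r : R) u v :
  (0 < n)%N -> 0 <= r ->
  (forall w x y, sqnormc w = 1 ->
     Re (w * form (N - c%:M) x y) <= r / 2 * (sqnorm x + sqnorm y)) ->
  exists w : C, exists2 t : R, sqnormc w = 1 & forall a b,
    `|Re (w * form N (a *: u + b *: v) (a *: u + b *: v))
      - t * sqnorm (a *: u + b *: v)| <= r / 2 * sqnorm (a *: u + b *: v).
Proof.
case: n N u v => [//|[|n]] N u v _ r0 hN.
  (* In dimension one there are no two orthonormal vectors, but N is a scalar and the strip shrinks
     to a line. *)
  exists 1; exists (Re (N 0 0)) => [|a b].
    by rewrite /sqnormc /= expr1n expr0n addr0.
  move: (a *: u + b *: v) => f; have -> : form N f f = (sqnorm f)%:C * N 0 0.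
    by rewrite {1}[N]mx11_scalar form_scalar mulrC.
  by rewrite mul1r ReM_real mulrC subrr normr0 mulr_ge0 ?divr_ge0 ?sqnorm_ge0.
pose V : 'M[C]_(2, n.+2) := col_mx u v.
(* The two rows of [schmidt V] are orthonormal and their span contains u and v, even if u and v are
   dependent. *)
have uW0 : schmidt V \is unitarymx by exact: schmidt_unitarymx.
have [P uP tP] := @Schur _ 2 (schmidt V *m N *m (schmidt V)^t* ) isT.
pose W := P *m schmidt V.
have uW : W \is unitarymx by apply: mul_unitarymx.
have [X VX] : exists X : 'M_2, V = X *m W.
  have /submxP[Y VY] := schmidt_sub V.
  exists (Y *m P^t* ); rewrite mulmxA -(mulmxA Y) -invmx_unitary //.
  by rewrite mulVmx ?unitarymx_unit // mulmx1.
pose T := W *m N *m W ^t*.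
have WW c' : W *m c'%:M *m W ^t* = c'%:M.
  by rewrite scalar_mxC -mulmxA (unitarymxP uW) mulmx1.
have T01 : T 0 1 = 0.
  move: tP; rewrite /similar_to conjymx // => /is_trig_mxP/(_ 0 1 isT).
  by rewrite /T /W ctrM !mulmxA.
have [|w [t w1 wt]] := @trig_numerical_strip T c r T01.
  move=> w x y w1; have := hN w (x *m W) (y *m W) w1.
  by rewrite form_mulmx mulmxBr mulmxBl WW !sqnorm_unitary.
exists w; exists t => // a b.
have -> : a *: u + b *: v = (row_mx a%:M b%:M : 'rV_2) *m X *m W.
  by rewrite -mulmxA -VX -!mul_scalar_mx -mul_row_col.
by rewrite form_mulmx sqnorm_unitary.
Qed.

(** Y and Z stand for the form on two vectors y and z, X for twice the real part of the cross term;
    the first hypothesis is positivity on s y - t z. Taking s = q, t = p gives X <= q a + p b,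
    exactly the missing terms of the product. *)
Lemma psd_split_scalar (X Y Z p q a b : R) :
  (forall s t, 0 <= s ^+ 2 * Y - s * t * X + t ^+ 2 * Z) ->
  0 <= p -> 0 <= q -> 0 <= a -> 0 <= b -> Y <= p * a -> Z <= q * b ->
  Y + X + Z <= (p + q) * (a + b).
Proof.
move=> h p0 q0 a0 b0 Yp Zq.
have [pp|pn] := ltP 0 p; last first.
  have pE : p = 0 by apply/eqP; rewrite eq_le pn p0.
  (* Now Y <= 0, and the chosen s, t turn positivity into X^2 <= (Z + 1)^2 Y, which forces X = 0. *)
  subst p; have := h (Z + 1) X; have : X <= 0 \/ 0 < X by case: (lerP X 0); auto.
  have Z0 : 0 <= Z by have := h 0 1; nra.
  by case; nra.
have [qp|qn] := ltP 0 q; last first.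
  have qE : q = 0 by apply/eqP; rewrite eq_le qn q0.
  subst q; have := h X (Y + 1); have : X <= 0 \/ 0 < X by case: (lerP X 0); auto.
  have Y0 : 0 <= Y by have := h 1 0; nra.
  by case; nra.
have pq : 0 < p * q by rewrite mulr_gt0.
have H := h q p; rewrite -(ler_pM2l pq).
have h1 : q ^+ 2 * Y <= q ^+ 2 * (p * a) by rewrite ler_wpM2l ?sqr_ge0.
have h2 : p ^+ 2 * Z <= p ^+ 2 * (q * b) by rewrite ler_wpM2l ?sqr_ge0.
have h3 : p * q * Y <= p * q * (p * a) by rewrite ler_wpM2l // ltW.
have h4 : p * q * Z <= p * q * (q * b) by rewrite ler_wpM2l // ltW.
by lra.
Qed.

Lemma possemidef_form_ge0 (n : nat) (M : 'M[C]_n) x :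
  possemidef M -> 0 <= Re (form M x x).
Proof.
move=> [_ /(_ (x ^t*))]; rewrite trmxCK -/(form M x x).
by rewrite lecE => /andP[].
Qed.

Lemma possemidef_split (n : nat) (M : 'M[C]_n) y z (p q a b : R) :
  possemidef M -> 0 <= p -> 0 <= q -> 0 <= a -> 0 <= b ->
  Re (form M y y) <= p * a -> Re (form M z z) <= q * b ->
  Re (form M (y + z) (y + z)) <= (p + q) * (a + b).
Proof.
move=> hM p0 q0 a0 b0 hy hz.
have -> : Re (form M (y + z) (y + z))
  = Re (form M y y) + (Re (form M y z) + Re (form M z y)) + Re (form M z z).
  by rewrite formDl !formDr !ReD !addrA.
apply: psd_split_scalar => // s t.
have := possemidef_form_ge0 (s%:C *: y + (- t)%:C *: z) hM.
rewrite !(formDl, formDr, formZl, formZr) !conjC_real !ReD !ReM_real.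
rewrite !ReD !ReM_real; move: (Re _) (Re _) (Re _) (Re _) => yy yz zy zz.
by congr (_ <= _); ring.
Qed.

(** The sign [e] covers both pieces of the splitting. The second component has a unimodular factor,
    so B contributes its plain form, and the two cross terms are conjugate. *)
Lemma form_block_twist (n : nat) (A B N : 'M[C]_n) (w : C) (f : 'rV_n) (e : R) :
  sqnormc w = 1 -> e ^+ 2 = 1 ->
  Re (form (block_mx A N (N ^t*) B) (row_mx f (e%:C * w^* *: f))
           (row_mx f (e%:C * w^* *: f)))
  = Re (form (A + B) f f) + 2 * e * Re (w * form N f f).
Proof.
move=> w1 e1; rewrite form_block !(formZl, formZr) form_ctr formDm.
rewrite !rmorphM /= conjC_real conjCK.
have -> : e%:C * w^* * (e%:C * w * form B f f) = form B f f.
  rewrite (_ : _ * _ = (e%:C ^+ 2) * (w * w^* ) * form B f f); last by ring.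
  by rewrite mulc_conj w1 -rmorphXn e1 !mul1r.
rewrite -[e%:C * w * _]mulrA -[e%:C * w^* * _]mulrA -rmorphM /=.
by rewrite !ReD !ReM_real Re_conj; ring.
Qed.

Lemma block_form_le (n : nat) (A B N : 'M[C]_n) (w : C) (t r mu : R) u v :
  possemidef (block_mx A N (N ^t*) B) -> sqnormc w = 1 ->
  (forall a b, `|Re (w * form N (a *: u + b *: v) (a *: u + b *: v))
      - t * sqnorm (a *: u + b *: v)| <= r / 2 * sqnorm (a *: u + b *: v)) ->
  (forall a b, Re (form (A + B) (a *: u + b *: v) (a *: u + b *: v))
     <= mu * sqnorm (a *: u + b *: v)) ->
  Re (form (block_mx A N (N ^t*) B) (row_mx u v) (row_mx u v))
    <= (mu + r) * (sqnorm u + sqnorm v).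
Proof.
move=> hM w1 hN hAB; set M := block_mx _ _ _ _ in hM *.
pose y f : 'rV[C]_(n + n) := row_mx f (w^* *: f).
pose z f : 'rV[C]_(n + n) := row_mx f (- w^* *: f).
have yE f : Re (form M (y f) (y f))
    = Re (form (A + B) f f) + 2 * Re (w * form N f f).
  by have := form_block_twist A B N f w1 (expr1n R 2); rewrite !mulr1 mul1r.
have zE f : Re (form M (z f) (z f))
    = Re (form (A + B) f f) - 2 * Re (w * form N f f).
  have e1 : (-1 : R) ^+ 2 = 1 by rewrite sqrrN expr1n.
  have := form_block_twist A B N f w1 e1.
  by rewrite rmorphN rmorph1 mulN1r mulrN1 mulNr.
(* These are mu + 2 (t + r/2) and mu - 2 (t - r/2), read off the two edges of the strip; p + q = 2
   (mu + r). *)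
pose p := mu + 2 * t + r; pose q := mu - 2 * t + r.
have yz a b : let f := a *: u + b *: v in
    Re (form M (y f) (y f)) <= p * sqnorm f /\
    Re (form M (z f) (z f)) <= q * sqnorm f.
  move=> f; rewrite yE zE; have := hAB a b; have := hN a b.
  rewrite -/f ler_norml /p /q; move: (Re _) (Re _) (sqnorm f) => n1 n2 n3.
  by move=> /andP[? ?] ?; split; lra.
have [x0|xn0] := eqVneq (sqnorm u + sqnorm v) 0.
  have /eqP-> : row_mx u v == 0 by rewrite -sqnorm_eq0 sqnorm_row_mx x0.
  by rewrite x0 mulr0 /form !mul0mx mxE.
have [f [[a [b fE]] f0]] :
    exists f, (exists a b, f = a *: u + b *: v) /\ 0 < sqnorm f.
  have [u0|u0] := eqVneq (sqnorm u) 0; last first.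
    exists u; split; last by rewrite lt_def u0 sqnorm_ge0.
    by exists 1; exists 0; rewrite scale1r scale0r addr0.
  exists v; split; last by move: xn0; rewrite u0 add0r lt_def sqnorm_ge0 andbT.
  by exists 0; exists 1; rewrite scale1r scale0r add0r.
(* Positivity of M on [y f] and [z f], for one nonzero f in the span, forces both signs. *)
have [p0 q0] : 0 <= p /\ 0 <= q.
  have [] := yz a b; rewrite -fE => yf zf.
  split; rewrite -(pmulr_lge0 _ f0); [apply: le_trans yf|apply: le_trans zf];
  exact: possemidef_form_ge0.
pose u' := (2^-1)%:C *: u + ((2^-1)%:C * w) *: v.
pose v' := (2^-1)%:C *: u + (- (2^-1)%:C * w) *: v.
have ww : w^* * w = 1 by rewrite mulrC mulc_conj w1.
have half : (2^-1)%:C + (2^-1)%:C = 1 :> C.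
  by rewrite -rmorphD /= (_ : 2^-1 + 2^-1 = 1) //; lra.
have u'E : u' = (2^-1)%:C *: (u + w *: v) by rewrite scalerDr scalerA.
have v'E : v' = (2^-1)%:C *: (u - w *: v).
  by rewrite scalerDr scalerN scalerA -scaleNr -mulNr.
have uvE : row_mx u v = y u' + z v'.
  rewrite add_row_mx u'E v'E; congr row_mx.
    by rewrite -scalerDr addrACA subrr addr0 scalerDr -scalerDl half scale1r.
  rewrite scaleNr -!scalerBr opprB addrC addrA subrK scalerDr -scalerDl half.
  by rewrite scale1r scalerA ww scale1r.
(* The parallelogram law; its factor 2 absorbs the one in p + q = 2 (mu + r). *)
have nE : sqnorm u + sqnorm v = 2 * (sqnorm u' + sqnorm v').
  rewrite u'E v'E !sqnormZ -mulrDr sqnorm_parallelogram sqnormZ w1 /sqnormc /=.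
  by rewrite expr0n addr0; field.
have [yu _] := yz (2^-1)%:C ((2^-1)%:C * w).
have [_ zv] := yz (2^-1)%:C (- (2^-1)%:C * w).
rewrite uvE nE; apply: le_trans (possemidef_split hM p0 q0 _ _ yu zv) _;
  rewrite ?sqnorm_ge0 //.
by rewrite mulrA (_ : (mu + r) * 2 = p + q) ?lexx // /p /q; ring.
Qed.

End BlockBound.

(** * Dimension count and conclusion *)

Theorem corollary2p4 (R : realType) (n : nat) (hn : (1 <= n)%N)
    (A B N : 'M[R[i]]_n)
    (hpos : possemidef (block_mx A N (N ^t*) B))
    (hnormal : N \is normalmx)
    (r : R)
    (hdisc : exists c : R[i],
      forall a : R[i], eigenvalue N a -> `|a - c| <= r%:C)
    (j : nat) (hj : (j < n)%N) :
  lambda (block_mx A N (N ^t*) B) (1 + 2 * j)%N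
    <= lambda (A + B) (1 + j)%N + r.
Proof.
have [c disc] := hdisc; set M := block_mx _ _ _ _ in hpos *.
have r0 : 0 <= r.
  have [a /disc ha] := eigenvalue_closed N hn.
  by rewrite -ler0c; apply: le_trans ha.
have hAB : A + B \is hermsymmx.
  have [/is_hermitianmxP + _] := hpos; rewrite expr0 scale1r /M.
  rewrite tr_block_mx map_block_mx => /eq_block_mx[AE _ _ BE].
  by apply/is_hermitianmxP; rewrite expr0 scale1r ctrD -AE -BE.
have [T1 hT1] := spectral_form hAB; have [T2 hT2] := spectral_form hpos.1.
have lt2j (k : 'I_(n + n - (1 + 2 * j))) : (1 + 2 * j + k < n + n)%N.
  by rewrite -ltn_subRL.
pose K1 := colsub (widen_ord (ltnW hj)) T1.
pose K2 := colsub (fun k => Ordinal (lt2j k)) T2.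
(* There are j conditions on u, j on v, and 2n - (1 + 2j) on x = (u, v): 2n - 1 in all, on 2n
   coordinates. *)
have [|x x0] := @exists_left_kernel R _ _ (row_mx (block_mx K1 0 0 K1) K2).
  by lia.
have xE := hsubmxK x; move: (lsubmx x) (rsubmx x) xE => u v xE.
rewrite mul_mx_row -row_mx0 => /eq_row_mx[+ xK2].
rewrite -xE mul_row_block !mulmx0 addr0 add0r -row_mx0.
move=> /eq_row_mx[uK1 vK1].
have low a b k : (k < j)%N -> forall kn : (k < n)%N,
    ((a *: u + b *: v) *m T1) 0 (Ordinal kn) = 0.
  move=> kj kn; have : (a *: u + b *: v) *m K1 = 0.
    by rewrite mulmxDl -!scalemxAl uK1 vK1 !scaler0 addr0.
  move=> /rowP/(_ (Ordinal kj)); rewrite !mxE => E; rewrite -[RHS]E.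
  by apply: eq_bigr => i _; rewrite !mxE; congr (_ * T1 _ _); exact: val_inj.
have high (k : 'I_(n + n)) : (2 * j < k)%N -> (x *m T2) 0 k = 0.
  move=> jk; have kn : (k - (1 + 2 * j) < n + n - (1 + 2 * j))%N.
    by have := ltn_ord k; lia.
  move/rowP/(_ (Ordinal kn)): xK2; rewrite !mxE => E; rewrite -[RHS]E.
  apply: eq_bigr => i _; rewrite !mxE; congr (_ * T2 _ _).
  by apply: val_inj => /=; lia.
(* [eigseq] is indexed from 0, so its entries j and 2j are [lambda] at 1 + j and 1 + 2j. *)
have fAB a b : complex.Re (form (A + B) (a *: u + b *: v) (a *: u + b *: v))
    <= (eigseq (A + B))`_j * sqnorm (a *: u + b *: v).
  have [-> ->] := hT1 (a *: u + b *: v); rewrite mulr_sumr; apply: ler_sum => k _.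
  have [kj|jk] := ltnP k j; last first.
    by rewrite ler_wpM2r ?sqnormc_ge0 ?eigseq_nth_anti.
  by case: k kj => k kn /= kj; rewrite low // /sqnormc /= expr0n addr0 !mulr0.
have fM : (eigseq M)`_(2 * j) * sqnorm x <= complex.Re (form M x x).
  have [-> ->] := hT2 x; rewrite mulr_sumr; apply: ler_sum => k _.
  have [jk|kj] := ltnP (2 * j) k; last first.
    by rewrite ler_wpM2r ?sqnormc_ge0 ?eigseq_nth_anti //; lia.
  by rewrite high // /sqnormc /= expr0n addr0 !mulr0.
have [w [t w1 hw]] :=
  two_dim_numerical_strip u v hn r0 (normal_disc_form hnormal disc).
have := block_form_le hpos w1 hw fAB; rewrite -sqnorm_row_mx xE.
by move/(le_trans fM); rewrite ler_pM2r // lt_def sqnorm_eq0 x0 sqnorm_ge0.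
Qed.
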